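(* Let $m$ be a nonnegative integer and let $G$ be a graph with two edge-disjoint loopless factors $M$ and $M_0$ satisfying $\Delta(M)\le m$ and $|E(M_0)|\le m$. If $G$ is $2m$-edge-connected, then $G$ has an $m$-tree-connected factor $H$ containing all edges of $M$ and no edges of $M_0$ such that $G\setminus E(H\cup M_0)$ is $(0,l)$-partition-connected, where $l(v)= \lfloor d_{G}(v)/2\rfloor-m$ for each vertex $v$. Furthermore, for an arbitrary given vertex $z$, $H$ can be chosen so that the same holds with $l(z)=\lceil d_{G}(z)/2\rceil -m$ (and $l(v)=\lfloor d_G(v)/2\rfloor-m$ for $v\neq z$).
   Context: Graphs may have loops and multiple edges. A factor of $G$ is a spanning subgraph; $\Delta(M)$ is the maximum degree of $M$. A graph is $m$-tree-connected if it contains $m$ edge-disjoint spanning trees. For an integer-valued function $l$ on $V(G)$, a graph is $(m,l)$-partition-connected if its edge set can be decomposed into an $m$-tree-connected factor and a factor $F$ which admits an orientation such that $d^+_F(v)\ge l(v)$ for each vertex $v$ (out-degree). In particular, $(0,l)$-partition-connected means the graph has an orientation with out-degree at least $l(v)$ at each vertex $v$. *)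

(* Defs.v *)
From mathcomp Require Import all_boot all_order all_algebra.

Set Implicit Arguments.
Unset Strict Implicit.
Unset Printing Implicit Defensive.

(* Finite undirected multigraphs; loops are the edges with both ends equal.
   The order of the two ends of an edge carries no meaning: every notion below
   is invariant under swapping the components of [ends e]. *)
Record mgraph := MGraph {
  vertex : finType;
  edge : finType;
  ends : edge -> vertex * vertex
}.

(* A factor (spanning subgraph) of G is identified with its edge set. *)
Notation factor G := {set edge G}.

Section Defs.
Variable G : mgraph.
Implicit Types (F H S T : factor G) (u v x : vertex G) (e : edge G).

Definition joins e u v : bool := (ends e == (u, v)) || (ends e == (v, u)).

Definition is_loop e : bool := (ends e).1 == (ends e).2.

Definition loopless F : Prop := forall e, e \in F -> ~~ is_loop e.

(* A loop contributes 2 to the degree of its end. *)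
Definition degree F v : nat :=
  \sum_(e in F) (((ends e).1 == v) + ((ends e).2 == v)).

Definition max_degree F : nat := \max_(v : vertex G) degree F v.

Definition adjacent F u v : bool := [exists e in F, joins e u v].

Definition connected F : Prop := forall u v, connect (adjacent F) u v.

Definition edge_connected (k : nat) : Prop :=
  forall S, #|S| < k -> connected (~: S).

(* A walk from x is given by its successive (edge, next vertex) steps. *)
Fixpoint walk F x (p : seq (edge G * vertex G)) : bool :=
  if p is (e, y) :: p' then [&& e \in F, joins e x y & walk F y p'] else true.

(* Loops are cycles of length 1, pairs of parallel edges cycles of length 2. *)
Definition is_cycle F x (p : seq (edge G * vertex G)) : bool :=
  [&& p != [::], walk F x p, last x (unzip2 p) == x,
      uniq (unzip1 p) & uniq (unzip2 p)].

Definition acyclic F : Prop := forall x p, ~~ is_cycle F x p.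

Definition spanning_tree T : Prop := connected T /\ acyclic T.

Definition tree_connected (m : nat) F : Prop :=
  exists T : 'I_m -> factor G,
    (forall i, T i \subset F /\ spanning_tree (T i)) /\
    (forall i j, i != j -> [disjoint T i & T j]).

(* D e is the pair (tail, head) of e; its values outside F are irrelevant. *)
Definition orientation F (D : edge G -> vertex G * vertex G) : Prop :=
  forall e, e \in F -> joins e (D e).1 (D e).2.

Definition out_degree F (D : edge G -> vertex G * vertex G) v : nat :=
  #|[set e in F | (D e).1 == v]|.

Definition partition_connected (m : nat) (l : vertex G -> int) F : Prop :=
  exists A B : factor G,
    [/\ A :|: B = F, [disjoint A & B], tree_connected m A &
        exists D, orientation B D /\
          forall v, (l v <= (out_degree B D v)%:Z)%R].

End Defs.

Arguments edge_connected : clear implicits.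

(* Main.v *)
(** Rado's theorem on independent transversals, in Welsh's version for monotone
    submodular functions, distributes the edges over m copies of the graphic
    matroid, the vertices (v receives l(v) outgoing edges) and a bin for left-over
    edges; edges of M may not go to vertices, and edges of M0 go only to the bin.
    The capacities add up to |E(G)|, so every part is filled exactly and each
    graphic part is connected.  Rado's condition becomes, for J disjoint from M0
    and Y the set of vertices met by no edge of J outside M,
      |J| + |M0| + m c(J) + l(Y) <= |E(G)| + m.
    As M has maximum degree at most m, one may isolate the vertices of Y in J;
    then sum the degrees outside J over the components of J, each of which has
    at least 2m leaving edges.  The rounding up at z is a parity gain. *)
From HB Require Import structures.
Require Import Defs.
From mathcomp Require Import all_boot all_order all_algebra.
From mathcomp Require Import zify.
Set Implicit Arguments.
Unset Strict Implicit.
Unset Printing Implicit Defensive.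
Import GRing.Theory.

(** * Rado's theorem for monotone submodular functions *)

Section Rado.
Variables (S : finType) (f : {set S} -> nat).
Hypothesis f0 : f set0 = 0.
Hypothesis f_mono : forall U W : {set S}, U \subset W -> f U <= f W.
Hypothesis f_submod : forall U W : {set S}, f (U :|: W) + f (U :&: W) <= f U + f W.

(** While some [A e] has two elements, one of them can be deleted without breaking the condition;
    once all sets are singletons, the condition is the conclusion. *)
Lemma rado_transversal (E : finType) (A : E -> {set S}) :
    (forall J : {set E}, #|J| <= f (\bigcup_(e in J) A e)) ->
  exists x : E -> S,
    (forall e, x e \in A e) /\ (forall J : {set E}, #|J| <= f (x @: J)).
Proof.
have [k] := ubnP (\sum_e #|A e|); elim: k => // k IHk in A * => ltk hall.
have A_neq0 e : A e != set0.
  by apply: contraTneq (hall [set e]) => Ae0; rewrite big_set1 Ae0 f0 cards1.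
case: (pickP (fun e => 1 < #|A e|)) => [e Ae_gt1 | A_le1]; last first.
  have /fin_all_exists[x Ax] e : exists s, A e = [set s].
    apply/cards1P; move: (A_le1 e) (A_neq0 e); rewrite -card_gt0; lia.
  exists x; split=> [e|J]; first by rewrite Ax set11.
  suff <-: \bigcup_(e in J) A e = x @: J by [].
  apply/setP=> s; apply/bigcupP/imsetP => -[e eJ].
    by rewrite Ax inE => /eqP->; exists e.
  by move=> ->; exists e; rewrite // Ax set11.
pose rm s e' := if e' == e then A e :\ s else A e'.
have rm_sub s e' : rm s e' \subset A e'.
  by rewrite /rm; case: eqP => [->|//]; apply: subsetDl.
have rm_lt s : s \in A e -> \sum_e' #|rm s e'| < k.
  move=> sAe; rewrite ltnS in ltk; apply: leq_trans ltk.
  rewrite (bigD1 e) //= [X in _ < X](bigD1 e) //= /rm eqxx (cardsD1 s (A e)) sAe.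
  rewrite add1n addSn ltnS leq_add2l.
  by apply: leq_sum => e' /negPf->.
have [s [t [sA tA nst]]] : exists s t, [/\ s \in A e, t \in A e & s != t].
  by case/card_gt1P: Ae_gt1 => s [t [? ? ?]]; exists s, t.
(* If deleting s and deleting t both failed, the two violating sets would
     contradict submodularity. *)
have dichotomy : (forall J : {set E}, #|J| <= f (\bigcup_(i in J) rm s i)) \/
    (forall J : {set E}, #|J| <= f (\bigcup_(i in J) rm t i)).
  case: (pickP (fun J : {set E} => f (\bigcup_(i in J) rm s i) < #|J|)) => [J hJ|no];
    last by left=> J; rewrite leqNgt no.
  case: (pickP (fun K : {set E} => f (\bigcup_(i in K) rm t i) < #|K|)) => [K hK|no];
    last by right=> K; rewrite leqNgt no.
  (* Only [A e] has shrunk, so a violating set contains [e]. *)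
  have eIn r (L : {set E}) : f (\bigcup_(i in L) rm r i) < #|L| -> e \in L.
    apply: contraLR => eL; rewrite -leqNgt (eq_bigr A) ?hall // => i iL.
    by rewrite /rm; case: eqP => // ei; rewrite -ei iL in eL.
  have [eJ eK] := (eIn _ _ hJ, eIn _ _ hK).
  (* Since [s] and [t] differ, the two shrunken copies of [A e] still cover [A e]. *)
  have hU : #|J :|: K| <= f (\bigcup_(i in J) rm s i :|: \bigcup_(i in K) rm t i).
    apply: leq_trans (hall _) (f_mono _); apply/bigcupsP=> i.
    have [-> _|ni] := eqVneq i e.
      apply/subsetP=> r rA; rewrite inE; have [rs|rs] := eqVneq r s.
        apply/orP; right; apply/bigcupP; exists e => //.
        by rewrite /rm eqxx !inE rA rs nst.
      by apply/orP; left; apply/bigcupP; exists e => //; rewrite /rm eqxx !inE rs.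
    rewrite inE => /orP[iJ|iK]; apply/subsetP=> r rA; rewrite inE; apply/orP.
      by left; apply/bigcupP; exists i; rewrite // /rm (negPf ni).
    by right; apply/bigcupP; exists i; rewrite // /rm (negPf ni).
  (* Dropping [e] loses one element, less than the total gap of at least two in the strict
     inequalities [hJ] and [hK]. *)
  have hI : #|J :&: K :\ e| <= f (\bigcup_(i in J) rm s i :&: \bigcup_(i in K) rm t i).
    apply: leq_trans (hall _) (f_mono _); apply/bigcupsP=> i.
    rewrite !inE => /andP[ni /andP[iJ iK]]; apply/subsetP=> r rA.
    by rewrite inE; apply/andP; split; apply/bigcupP; exists i;
       rewrite // /rm (negPf ni).
  have eJK : e \in J :&: K by rewrite inE eJ.
  move: (f_submod (\bigcup_(i in J) rm s i) (\bigcup_(i in K) rm t i)) (cardsUI J K).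
  move: hU hI hJ hK; rewrite (cardsD1 e (J :&: K)) eJK; lia.
have: exists2 r, r \in A e & forall J : {set E}, #|J| <= f (\bigcup_(i in J) rm r i).
  by case: dichotomy; [exists s | exists t].
case=> r rA /(IHk _ (rm_lt r rA))[x [xA hx]].
by exists x; split=> // e'; apply: (subsetP (rm_sub r e')).
Qed.
End Rado.

(** * Components of an edge set, counted by locally constant potentials *)

Section LocallyConstant.
Variable G : mgraph.
Implicit Types (J K : factor G) (u v : vertex G) (e : edge G).

Definition potential := {ffun vertex G -> rat^o}.

Definition difference e (phi : potential) : rat^o :=
  (phi (ends e).1 - phi (ends e).2)%R.

Lemma difference_is_linear e : linear (difference e).
Proof.
move=> a phi psi; rewrite /difference !ffunE /=.
by rewrite scalerBr opprD addrACA.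
Qed.
HB.instance Definition _ e :=
  GRing.isLinear.Build rat potential rat^o _ (difference e) (difference_is_linear e).

Definition loc_const J : {vspace potential} :=
  (\bigcap_(e in J) lker (linfun (difference e)))%VS.

(* The number of connected components of J: working with a dimension makes
   supermodularity immediate. *)
Definition ncomp J : nat := \dim (loc_const J).

Lemma loc_constP J (phi : potential) :
  reflect (forall e, e \in J -> phi (ends e).1 = phi (ends e).2)
          (phi \in loc_const J).
Proof.
apply: (iffP subv_bigcapP) => [h e eJ | h e eJ].
  by move: (h e eJ); rewrite -memvE memv_ker lfunE subr_eq0 => /eqP.
by rewrite -memvE memv_ker lfunE subr_eq0 h.
Qed.

Lemma loc_constS J K : J \subset K -> (loc_const K <= loc_const J)%VS.
Proof.
move=> sJK; apply/subvP=> phi /loc_constP h; apply/loc_constP=> e eJ.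
exact: h (subsetP sJK e eJ).
Qed.

Lemma ncompS J K : J \subset K -> ncomp K <= ncomp J.
Proof. by move/loc_constS/dimvS. Qed.

Lemma ncomp0 : ncomp set0 = \dim {:potential}.
Proof. by rewrite /ncomp /loc_const big_set0. Qed.

(** The dimension formula: the two spaces intersect inside [loc_const (J :|: K)], and their sum lies
    in [loc_const (J :&: K)]. *)
Lemma ncomp_supermod J K :
  ncomp J + ncomp K <= ncomp (J :|: K) + ncomp (J :&: K).
Proof.
rewrite /ncomp -dimv_sum_cap addnC leq_add ?dimvS //.
  apply/subvP=> phi; rewrite memv_cap => /andP[/loc_constP hJ /loc_constP hK].
  by apply/loc_constP=> e; rewrite inE => /orP[/hJ|/hK].
by rewrite subv_add !loc_constS ?subsetIl ?subsetIr.
Qed.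

Definition indicator (P : pred (vertex G)) : potential :=
  [ffun v => (P v)%:R%R].

Lemma adjacent_sym J : symmetric (adjacent J).
Proof.
by move=> u v; apply: eq_existsb => e; rewrite /joins orbC.
Qed.

Lemma connect_adjacent_sym J : connect_sym (adjacent J).
Proof. exact/sym_connect_sym/adjacent_sym. Qed.

Lemma adjacent_ends J e : e \in J -> adjacent J (ends e).1 (ends e).2.
Proof.
by move=> eJ; apply/existsP; exists e; rewrite eJ /joins -surjective_pairing eqxx.
Qed.

Lemma adjacentP J u v :
  reflect (exists2 e, e \in J & ends e = (u, v) \/ ends e = (v, u))
          (adjacent J u v).
Proof.
apply: (iffP existsP) => [[e /andP[eJ]]|[e eJ h]].
  by case/orP=> /eqP; exists e; auto.
by exists e; rewrite eJ /joins; case: h => ->; rewrite eqxx ?orbT.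
Qed.

Lemma loc_const_connect J (phi : potential) u v :
  phi \in loc_const J -> connect (adjacent J) u v -> phi u = phi v.
Proof.
move=> /loc_constP h cuv.
have cl : closed (adjacent J) [pred w | phi w == phi v].
  move=> x y /adjacentP[e /h eh [E|E]]; rewrite E /= in eh; by rewrite !inE eh.
by move: (closed_connect cl cuv); rewrite !inE eqxx => /eqP.
Qed.

Lemma indicator_loc_const J u : indicator (connect (adjacent J) u) \in loc_const J.
Proof.
apply/loc_constP=> e eJ; rewrite !ffunE; congr (_%:R)%R; congr nat_of_bool.
exact: (same_connect_r (connect_adjacent_sym J) (connect1 (adjacent_ends eJ))).
Qed.

(** A locally constant potential is the combination of the component indicators weighted by its
    values at the roots, so these indicators span. *)
Lemma ncomp_le_roots J : ncomp J <= #|roots (adjacent J)|.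
Proof.
pose X := [seq indicator (connect (adjacent J) r) | r in roots (adjacent J)].
suff: (loc_const J <= <<X>>)%VS.
  by move/dimvS/leq_trans; apply; rewrite (leq_trans (dim_span X)) // size_image.
apply/subvP=> phi phiJ.
have -> : phi = (\sum_(r in roots (adjacent J))
                   phi r *: indicator (connect (adjacent J) r))%R.
  apply/ffunP=> v; rewrite sum_ffunE.
  rewrite (bigD1 (fingraph.root (adjacent J) v)) /=; last first.
    exact: roots_root (connect_adjacent_sym J) _.
  rewrite big1 => [|r /andP[/eqP rr nrv]]; rewrite !ffunE.
    rewrite addr0 (connect_adjacent_sym J) connect_root.
    rewrite -(loc_const_connect phiJ (connect_root _ v)).
    exact/esym/mulr1.
  rewrite -(root_connect (connect_adjacent_sym J)) rr (negPf nrv) /=.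
  exact: mulr0.
apply: memv_suml => r rJ; rewrite memvZ // memv_span //.
exact: image_f.
Qed.

(** If [u] and [v] were not joined, the indicator of the component of [u] and the constant one would
    be independent. *)
Lemma ncomp1_connected J : ncomp J <= 1 -> connected J.
Proof.
move=> n1 u v; apply: contraT => nuv.
pose phi := indicator (connect (adjacent J) u).
pose one := indicator predT.
have oneJ : one \in loc_const J by apply/loc_constP=> e _; rewrite !ffunE.
have : (<<[:: phi; one]>> <= loc_const J)%VS.
  apply/span_subvP=> psi; rewrite !inE => /orP[]/eqP-> //.
  exact: indicator_loc_const.
move/dimvS/leq_trans/(_ n1) => d1.
have : free [:: phi; one].
  rewrite free_cons seq1_free.
  have -> : one != 0%R.
    by apply/eqP=> /ffunP/(_ u); rewrite !ffunE.
  rewrite andbT span_seq1; apply/negP => /vlineP[k /ffunP E].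
  move: (E u) (E v); rewrite !ffunE connect0 (negPf nuv) /= => <-.
  by [].
by rewrite /free => /eqP E; rewrite E in d1.
Qed.

Lemma ncomp_gt0 J v : 0 < ncomp J.
Proof.
rewrite lt0n dimv_eq0; apply/eqP=> J0.
have : indicator predT \in loc_const J by apply/loc_constP=> e _; rewrite !ffunE.
by rewrite J0 memv0 => /eqP/ffunP/(_ v); rewrite !ffunE.
Qed.

Definition star J v : factor G :=
  [set e in J | ((ends e).1 == v) || ((ends e).2 == v)].

Lemma card_star J v : #|star J v| <= degree J v.
Proof.
rewrite -sum1_card /degree [X in _ <= X](bigID (mem (star J v))) /=.
apply: leq_trans (leq_addr _ _).
rewrite (eq_bigl (fun e => (e \in J) && (e \in star J v))) => [|e]; last first.
  by rewrite inE andbA andbb.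
by apply: leq_sum => e /andP[_]; rewrite inE => /andP[_]; do 2!case: eqP.
Qed.

(* Isolating a vertex of J-degree at most m creates a component, which pays
   for the deleted edges. *)
Lemma isolate_vertex J v m : loopless (star J v) -> #|star J v| <= m ->
  #|J| + m * ncomp J <= #|J :\: star J v| + m * ncomp (J :\: star J v).
Proof.
move=> noloop le_m.
have [-> | [e eS]] := set_0Vmem (star J v); first by rewrite setD0.
suff : ncomp J < ncomp (J :\: star J v).
  have sSJ : star J v \subset J by apply/subsetP=> e'; rewrite inE => /andP[].
  move=> lt; rewrite cardsD (setIidPr sSJ).
  by have := subset_leq_card sSJ; move: lt le_m; nia.
have sub := loc_constS (subsetDl J (star J v)).
rewrite /ncomp (ltn_leqif (dimv_leqif_eq sub)).
apply/negP=> /eqP eqK.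
(* This indicator is locally constant once the star is gone, but not along the non-loop edge [e] at
   [v]. *)
have : indicator (pred1 v) \in loc_const J.
  rewrite eqK; apply/loc_constP=> e'; rewrite !inE => /andP[nS e'J].
  move: nS; rewrite e'J /= negb_or => /andP[/negPf n1 /negPf n2].
  by rewrite !ffunE /= n1 n2.
have := noloop e eS; move: eS; rewrite inE /is_loop => /andP[eJ inc] nl /loc_constP/(_ e eJ).
rewrite !ffunE /=; case/orP: inc nl => /eqP->.
  by rewrite eq_sym eqxx => /negPf->.
by rewrite eqxx => /negPf->.
Qed.
End LocallyConstant.

(** * Degree counts, the inequality behind Rado's condition, and spanning trees *)

Section Counting.
Variable G : mgraph.
Implicit Types (J : factor G) (u v y z : vertex G) (e : edge G).

(** Deleting the crossing edges makes [B] closed under adjacency, which separates [u] from [w]. *)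
Lemma card_cut k (B : {pred vertex G}) u w :
    edge_connected G k -> u \in B -> w \notin B ->
  k <= #|[set e : edge G | ((ends e).1 \in B) != ((ends e).2 \in B)]|.
Proof.
move=> conn uB wB; rewrite leqNgt; apply: contra wB => /conn/(_ u w) cuw.
rewrite -(closed_connect _ cuw) // => x y /adjacentP[e].
by rewrite !inE negbK => /eqP h [E|E]; rewrite E in h.
Qed.

Lemma sum_degree J (B : {pred vertex G}) :
  \sum_(v in B) degree J v =
  \sum_(e in J) (((ends e).1 \in B) + ((ends e).2 \in B)).
Proof.
have sum_eq u : \sum_(v in B) (u == v) = (u \in B).
  rewrite -big_mkcondr /= sum1dep_card.
  case: (boolP (u \in B)) => uB.
    rewrite (_ : [set _ | _] = [set u]) ?cards1 //.
    by apply/setP=> v; rewrite !inE eq_sym; case: eqP => [->|]; rewrite ?uB ?andbF.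
  rewrite (_ : [set _ | _] = set0) ?cards0 //.
  by apply/setP=> v; rewrite !inE eq_sym; case: eqP => [->|]; rewrite ?(negPf uB) ?andbF.
rewrite exchange_big; apply: eq_bigr => e _ /=.
by rewrite big_split /= !sum_eq.
Qed.

Lemma handshake J : \sum_v degree J v = 2 * #|J|.
Proof.
rewrite (eq_bigl (mem predT)) // sum_degree.
by rewrite (eq_bigr (fun=> 2)) // sum_nat_const mulnC.
Qed.

Lemma degree_setCE J v : star J v = set0 -> degree (~: J) v = degree [set: edge G] v.
Proof.
move=> J0; rewrite /degree [RHS](bigID (mem J)) /= [X in X + _]big1 => [|e]; last first.
  case/andP=> _ eJ; have : e \notin star J v by rewrite J0 inE.
  by rewrite inE eJ /= negb_or => /andP[/negPf-> /negPf->].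
by rewrite add0n; apply: eq_bigl => e; rewrite !inE.
Qed.

Lemma connect_isolated J v w : star J v = set0 -> connect (adjacent J) v w -> w = v.
Proof.
move=> J0 cvw; apply/eqP; have cl : closed (adjacent J) (pred1 v).
  move=> x y /adjacentP[e eJ E]; have : e \notin star J v by rewrite J0 inE.
  rewrite inE eJ /= negb_or !inE.
  by case: E => -> /= /andP[/negPf-> /negPf->].
by move: (closed_connect cl cvw); rewrite !inE eqxx => <-.
Qed.

(** Truncated subtraction replaces a negative bound by zero, which only strengthens the out-degree
    requirement. *)
Definition demand m z v : nat :=
  (if v == z then uphalf (degree [set: edge G] v)
   else (degree [set: edge G] v)./2) - m.

(** Degrees outside [J] are summed over the components: each contributes at least [2 * m], and a
    vertex of [Y], being a component by itself, contributes its full degree. *)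
Lemma components_bound m z J (Y : {pred vertex G}) :
    edge_connected G (2 * m) -> (forall y, y \in Y -> star J y = set0) ->
    1 < #|roots (adjacent J)| ->
  m * ncomp J + \sum_(y in Y) demand m z y <= #|~: J|.
Proof.
move=> conn isoY gt1; set rt := fingraph.root (adjacent J).
have csym := connect_adjacent_sym J.
have block_ge r : r \in roots (adjacent J) ->
    2 * m <= \sum_(v | rt v == r) degree (~: J) v.
  move=> rR.
  (* A second component supplies the far side of the cut. *)
  have [r' r'R nrr'] : exists2 r', r' \in roots (adjacent J) & r' != r.
    case/card_gt1P: gt1 => a [b [aR bR nab]].
    have [ar|] := eqVneq a r; last by exists a.
    by exists b; rewrite // -ar eq_sym.
  pose B : {pred vertex G} := [pred v | rt v == r].
  have rB : r \in B by rewrite inE.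
  have r'B : r' \notin B by rewrite inE /rt (eqP r'R).
  apply: leq_trans (card_cut conn rB r'B) _.
  rewrite (eq_bigl (mem B)) // sum_degree -sum1_card.
  rewrite [X in _ <= X](bigID (fun e => ((ends e).1 \in B) != ((ends e).2 \in B))) /=.
  apply: leq_trans (leq_addr _ _).
  rewrite [X in _ <= X](eq_bigl (mem [set e | ((ends e).1 \in B) != ((ends e).2 \in B)])).
    by apply: leq_sum => e; rewrite inE; do 2!case: (_ \in B).
  (* An edge of [J] has both ends in one component, so crossing edges avoid [J]. *)
  move=> e; rewrite !inE; case: (boolP (e \in J)) => //= eJ.
  have /eqP -> : rt (ends e).1 == rt (ends e).2.
    by rewrite (root_connect csym) connect1 // adjacent_ends.
  by rewrite eqxx.
have block_Y r : r \in roots (adjacent J) ->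
    2 * m + \sum_(v | (v \in Y) && (rt v == r)) (degree [set: edge G] v - 2 * m)
      <= \sum_(v | rt v == r) degree (~: J) v.
  move=> rR; have := block_ge r rR.
  case: (pickP (fun v => (v \in Y) && (rt v == r))) => [y /andP[yY yr]|no]; last first.
    by rewrite (eq_bigl _ _ no) big_pred0_eq addn0.
  have only v : (rt v == r) = (v == y).
    apply/idP/eqP => [vr|->//]; apply: (@connect_isolated J y); first exact: isoY.
    by rewrite -(root_connect csym) -/rt (eqP vr) (eqP yr).
  have onlyY v : (v \in Y) && (rt v == r) = (v == y).
    by rewrite only; case: eqP => [->|]; rewrite ?yY ?andbF.
  rewrite (eq_bigl _ _ onlyY) (eq_bigl _ _ only) !big_pred1_eq.
  by rewrite degree_setCE ?isoY // => h; rewrite subnKC.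
have total : 2 * m * #|roots (adjacent J)| +
    \sum_(v in Y) (degree [set: edge G] v - 2 * m) <= 2 * #|~: J|.
  rewrite -handshake.
  rewrite (partition_big rt (mem (roots (adjacent J)))) => [|v _]; last exact: roots_root.
  rewrite [X in _ <= X](partition_big rt (mem (roots (adjacent J)))) => [|v _]; last exact: roots_root.
  by rewrite mulnC -sum_nat_const -big_split; apply: leq_sum => r /block_Y.
(* Rounding up at [z] costs at most one in the doubled sum; the final comparison is between even
   numbers, so this one is absorbed. *)
have dem : 2 * \sum_(y in Y) demand m z y <=
    \sum_(v in Y) (degree [set: edge G] v - 2 * m) + 1.
  rewrite big_distrr /=.
  apply: (@leq_trans (\sum_(v in Y) ((degree [set: edge G] v - 2 * m) + (v == z)))).
    by apply: leq_sum => y _; rewrite /demand; case: eqP => _; lia.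
  rewrite big_split leq_add2l /= -big_mkcondr /= sum1dep_card -(cards1 z).
  by apply: subset_leq_card; apply/subsetP=> v; rewrite !inE => /andP[].
have := leq_mul (leqnn m) (ncomp_le_roots J); lia.
Qed.

(** Induction on [#|J|]. Isolating a vertex met by no edge of [J :\: M] does not lower the left
    side; when all such vertices are isolated, either [components_bound] applies or [J] is connected
    and the bound is direct. *)
Lemma rado_inequality m (M M0 J : factor G) z :
    loopless M -> loopless M0 -> max_degree M <= m -> #|M0| <= m ->
    edge_connected G (2 * m) -> [disjoint J & M0] ->
  #|J| + #|M0| + m * ncomp J + \sum_(v | star (J :\: M) v == set0) demand m z v
    <= #|edge G| + m.
Proof.
move=> hM hM0 hdeg hcard conn.
have [k] := ubnP #|J|; elim: k => // k IHk in J * => ltk dis.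
case: (pickP (fun y => (star (J :\: M) y == set0) && (star J y != set0)))
    => [y /andP[/eqP Yy Jy]|no].
  (* At [y] all edges of [J] lie in [M], so the degree bound on [M] limits the star. *)
  have starM : star J y \subset star M y.
    apply/subsetP=> e; rewrite !inE => /andP[eJ inc]; rewrite inc andbT.
    have : e \notin star (J :\: M) y by rewrite Yy inE.
    by rewrite !inE eJ inc !andbT negbK.
  have le_m : #|star J y| <= m.
    apply: leq_trans (subset_leq_card starM) _; apply: leq_trans (card_star _ _) _.
    by apply: leq_trans hdeg; apply: (leq_bigmax y).
  have noloop : loopless (star J y).
    by move=> e /(subsetP starM); rewrite inE => /andP[/hM].
  have := isolate_vertex noloop le_m.
  have subJ : star J y \subset J by apply/subsetP=> e; rewrite inE => /andP[].
  have lt : #|J :\: star J y| < k.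
    rewrite ltnS in ltk; apply: leq_trans ltk.
    apply: proper_card; rewrite properEneq subsetDl andbT.
    apply: contraNneq Jy => E; rewrite -subset0; apply/subsetP=> e eS.
    by move: (subsetP subJ e eS); rewrite -E inE eS.
  have dis' : [disjoint J :\: star J y & M0].
    exact: disjointWl (subsetDl _ _) dis.
  have := IHk _ lt dis'.
  (* The deleted edges lie in [M], so the demand sum is unchanged. *)
  rewrite (_ : J :\: star J y :\: M = J :\: M); first by lia.
  apply/setP=> e; rewrite !inE; case: (boolP (e \in M)) => //= eM.
  case: (boolP (e \in J)) => //= eJ.
  have : e \notin star (J :\: M) y by rewrite Yy inE.
  by rewrite !inE eJ eM /= => ->.
have isoY y : y \in [pred v | star (J :\: M) v == set0] -> star J y = set0.
  by rewrite inE => Yy; apply/eqP; move: (no y); rewrite Yy => /negbFE.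
(* With several components, the summand [m] on the right pays for [M0]. *)
have [gt1 | le1] := ltnP 1 #|roots (adjacent J)|.
  have : m * ncomp J + \sum_(v | star (J :\: M) v == set0) demand m z v
    <= #|~: J| := components_bound z conn isoY gt1.
  have := cardsC J; lia.
have connJ u v : connect (adjacent J) u v.
  have csym := connect_adjacent_sym J.
  rewrite -(root_connect csym); apply/eqP.
  by apply: (card_le1_eqP le1); apply: roots_root.
have le1' : ncomp J <= 1 := leq_trans (ncomp_le_roots J) le1.
case: (pickP (fun y => star (J :\: M) y == set0)) => [y Yy|noY]; last first.
  rewrite big_pred0 // addn0 -cardsUI (disjoint_setI0 dis) cards0 addn0.
  by have := max_card (J :|: M0); nia.
(* An isolated vertex of a connected [J] is the only vertex: [J] is then empty, the loopless [M0]
   too, and the degree of [y] is twice [#|edge G|]. *)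
have Vy v : v = y by apply: connect_isolated (isoY y Yy) (connJ y v).
have J0 : J = set0.
  apply/eqP; rewrite -subset0; apply/subsetP=> e eJ.
  by rewrite -(isoY y Yy) inE eJ (Vy (ends e).1) eqxx.
have M00 : M0 = set0.
  apply/eqP; rewrite -subset0; apply/subsetP=> e /hM0.
  by rewrite /is_loop (Vy (ends e).1) (Vy (ends e).2) eqxx.
rewrite (big_pred1 y) => [|v]; last by rewrite (Vy v) Yy /= eqxx.
have := handshake [set: edge G]; rewrite cardsT (big_pred1 y) => [|v]; last by rewrite (Vy v) /= eqxx.
rewrite /demand {1}J0 M00 !cards0; case: eqP => _; nia.
Qed.

(** A minimal connected subset has no cycle: the rest of a cycle joins the ends of its first edge,
    which could be deleted. *)
Lemma spanning_tree_sub F : connected F -> exists2 T : factor G, T \subset F & spanning_tree T.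
Proof.
pose conn (T : factor G) := [forall u, forall v, connect (adjacent T) u v].
have connP T : reflect (connected T) (conn T).
  by apply: (iffP 'forall_forallP).
move/connP/minset_exists=> [T /minsetP[/connP cT minT] sTF]; exists T => //; split=> //.
move=> x [|[e y] p] //; apply/negP=> /and5P[_ /= /and3P[eT exy wp] lastp /andP[ep up] _].
suff /connP/minT : connected (T :\ e).
  by move/(_ (subsetDl _ _))/setP/(_ e); rewrite !inE eqxx eT.
have cyx : connect (adjacent (T :\ e)) y x.
  rewrite -(eqP lastp).
  elim: p y ep wp {exy lastp up} => [|[e' y'] p IHp] y //=.
  rewrite inE negb_or => /andP[nee' ep] /and3P[e'T e'y wp].
  apply: connect_trans (IHp y' ep wp); apply: connect1.
  by apply/existsP; exists e'; rewrite !inE e'T e'y eq_sym nee'.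
have cxy : connect (adjacent (T :\ e)) x y by rewrite connect_adjacent_sym.
move=> u v; move: (cT u v); apply: connect_sub => a b /existsP[e' /andP[e'T e'ab]].
have [ee'|nee'] := eqVneq e' e; last first.
  by apply: connect1; apply/existsP; exists e'; rewrite !inE nee' e'T.
move: e'ab exy; rewrite ee' /joins.
by case/orP=> /eqP-> /orP[] /eqP[-> ->].
Qed.
End Counting.

(** * Assigning edges to trees and vertices by Rado's theorem *)

Section Decomposition.
Variables (G : mgraph) (m : nat).

(* An edge is placed into one of the m future trees ([inl (i, e)]), given to
   one of its ends as an outgoing edge ([inr (Some v)]), or left over
   ([inr None]). *)
Notation slot := ('I_m * edge G + option (vertex G))%type.
Implicit Types (U W : {set slot}) (e : edge G) (v z : vertex G).

Let N := \dim {:potential G}.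

Definition tree_part U (i : 'I_m) : factor G := [set e | inl (i, e) \in U].

(** The first sum is the rank in [m] disjoint copies of the graphic matroid, with [N] the number of
    vertices. A slot [inr o] is a single element of weight [w o], so up to [w o] edges may share
    it. *)
Definition slot_rank (w : option (vertex G) -> nat) U : nat :=
  \sum_i (N - ncomp (tree_part U i)) + \sum_(o | inr o \in U) w o.

Lemma ncomp_le_dim (J : factor G) : ncomp J <= N.
Proof. by rewrite /N -ncomp0 ncompS ?sub0set. Qed.

Lemma slot_rank0 w : slot_rank w set0 = 0.
Proof.
rewrite /slot_rank [X in _ + X]big_pred0 => [|o]; last by rewrite inE.
rewrite addn0 big1 // => i _; rewrite (_ : tree_part _ _ = set0) ?ncomp0 ?subnn //.
by apply/setP=> e; rewrite !inE.
Qed.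

Lemma slot_rankS w U W : U \subset W -> slot_rank w U <= slot_rank w W.
Proof.
move=> sUW; apply: leq_add.
  apply: leq_sum => i _; apply/leq_sub2l/ncompS/subsetP => e.
  by rewrite !inE; apply: (subsetP sUW).
rewrite big_mkcond [X in _ <= X]big_mkcond; apply: leq_sum => o _.
by case: ifP => // /(subsetP sUW)->.
Qed.

Lemma slot_rank_submod w U W :
  slot_rank w (U :|: W) + slot_rank w (U :&: W) <= slot_rank w U + slot_rank w W.
Proof.
rewrite /slot_rank addnACA [X in _ <= X]addnACA; apply: leq_add.
  rewrite -!big_split; apply: leq_sum => i _ /=.
  have -> : tree_part (U :|: W) i = tree_part U i :|: tree_part W i.
    by apply/setP=> e; rewrite !inE.
  have -> : tree_part (U :&: W) i = tree_part U i :&: tree_part W i.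
    by apply/setP=> e; rewrite !inE.
  have := ncomp_supermod (tree_part U i) (tree_part W i).
  (* These bounds make the truncated subtractions exact. *)
  have := ncomp_le_dim (tree_part U i :|: tree_part W i).
  have := ncomp_le_dim (tree_part U i :&: tree_part W i).
  have := ncomp_le_dim (tree_part U i); have := ncomp_le_dim (tree_part W i); lia.
have cond X : \sum_(o | inr o \in X) w o = \sum_o (if inr o \in X then w o else 0).
  exact: big_mkcond.
rewrite !cond -!big_split; apply: leq_sum => o _ /=.
by rewrite !inE; do 2!case: (inr o \in _) => //=; rewrite addnC.
Qed.

Variables (M M0 : factor G) (z : vertex G).
Hypotheses (hM : loopless M) (hM0 : loopless M0) (hdisj : [disjoint M & M0]).
Hypotheses (hdeg : max_degree M <= m) (hcard : #|M0| <= m).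
Hypothesis hconn : edge_connected G (2 * m).

Definition slots e : {set slot} :=
  [set s | match s with
           | inl (_, e') => (e' == e) && (e \notin M0)
           | inr (Some v) => [&& e \notin M0, e \notin M
                                & ((ends e).1 == v) || ((ends e).2 == v)]
           | inr None => true
           end].

Definition capacity (o : option (vertex G)) : nat :=
  if o is Some v then demand m z v
  else #|edge G| - (m * (N - 1) + \sum_v demand m z v).

Lemma dim_gt0 : 0 < N.
Proof. by rewrite /N -ncomp0 (ncomp_gt0 _ z). Qed.

(** The subtraction in [capacity None] is not truncated: this is [rado_inequality] for the empty
    [J], where [ncomp] is [N] and every vertex is isolated. *)
Lemma capacity_total : m * (N - 1) + \sum_o capacity o = #|edge G|.
Proof.
have : m * (N - 1) + \sum_v demand m z v <= #|edge G|.
  have := @rado_inequality G m M M0 set0 z hM hM0 hdeg hcard hconn.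
  rewrite disjoints_subset sub0set cards0 ncomp0 -/N => /(_ isT).
  rewrite (eq_bigl xpredT) => [|v]; first by have := dim_gt0; nia.
  by apply/eqP/setP=> e; rewrite !inE andbF.
have -> : \sum_o capacity o = capacity None + \sum_v demand m z v.
  rewrite (bigD1 None) //=; congr addn.
  rewrite (reindex_omap Some id) => [|[v|]] //=.
  by apply: eq_bigl => v; rewrite eqxx.
rewrite /capacity; lia.
Qed.

(** The union of the slots has rank [m * (N - ncomp J')] plus the total capacity minus the demands
    of the vertices it misses; [capacity_total] turns the claim into [rado_inequality] for [J']. *)
Lemma slots_hall (J : {set edge G}) :
  #|J| <= slot_rank capacity (\bigcup_(e in J) slots e).
Proof.
(* The left-over slot lies in the union only when [J] is nonempty. *)
have [->|[e0 e0J]] := set_0Vmem J; first by rewrite cards0.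
pose J' := J :\: M0.
have dis : [disjoint J' & M0] by rewrite disjoints_subset subsetDr.
have key := @rado_inequality G m M M0 J' z hM hM0 hdeg hcard hconn dis.
set U := \bigcup_(e in J) slots e.
have tpU i : tree_part U i = J'.
  apply/setP=> e; rewrite !inE; apply/bigcupP/andP => [[e' e'J]|[eM0 eJ]].
    by rewrite inE => /andP[/eqP-> eM0].
  by exists e; rewrite // inE eqxx.
have inU v : (inr (Some v) \in U) = (star (J' :\: M) v != set0).
  apply/bigcupP/set0Pn => -[e].
    by move=> eJ; rewrite inE => /and3P[eM0 eM inc]; exists e; rewrite !inE eM0 eM eJ.
  rewrite !inE => /andP[/and3P[eM eM0 eJ] inc].
  by exists e; rewrite // inE eM eM0.
have noneU : inr None \in U by apply/bigcupP; exists e0; rewrite // inE.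
have sizeJ : #|J| <= #|J'| + #|M0|.
  rewrite -(cardsID M0 J) addnC leq_add2l; exact/subset_leq_card/subsetIr.
rewrite /slot_rank (eq_bigr (fun=> N - ncomp J')) => [|i _]; last by rewrite tpU.
rewrite sum_nat_const card_ord.
have capU : \sum_(o | inr o \in U) capacity o + \sum_(v | star (J' :\: M) v == set0) demand m z v
   = \sum_o capacity o.
  rewrite (bigID (fun o => inr o \in U) xpredT) /=; congr addn.
  rewrite (reindex_omap Some id) => [|[v|]] //=; last by rewrite noneU.
  by apply: eq_bigl => v; rewrite inU negbK eqxx andbT.
have := capacity_total; have := ncomp_le_dim J'; have := dim_gt0.
move: key sizeJ capU; nia.
Qed.

Lemma tree_orientation_decomposition : exists H : factor G,
  [/\ tree_connected m H, M \subset H, [disjoint H & M0] &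
      partition_connected 0 (fun v => (demand m z v)%:Z%R) (~: (H :|: M0))].
Proof.
have [x [xslot xrank]] :=
  rado_transversal (slot_rank0 capacity) (@slot_rankS capacity)
    (@slot_rank_submod capacity) slots_hall.
pose tree (i : 'I_m) : factor G := [set e | x e == inl (i, e)].
pose out (o : option (vertex G)) : factor G := [set e | x e == inr o].
(* Applied to the edges placed in copy [i], the rank bound says that they are independent in the
   graphic matroid. *)
have tree_le i : #|tree i| <= N - ncomp (tree i).
  apply: leq_trans (xrank (tree i)) _; rewrite /slot_rank.
  rewrite [X in _ + X]big_pred0 => [|o]; last first.
    by apply/imsetP=> -[e]; rewrite inE => /eqP->.
  rewrite addn0 (bigD1 i) //= big1 ?addn0 => [|j nji].
    rewrite (_ : tree_part _ _ = tree i) //; apply/setP=> e; rewrite inE.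
    apply/imsetP/idP => [[e' e'T]|eT]; last first.
      by exists e; rewrite //; move: eT; rewrite inE => /eqP->.
    by move: (e'T); rewrite inE => /eqP-> [->].
  rewrite (_ : tree_part _ _ = set0) ?ncomp0 ?subnn //; apply/setP=> e; rewrite !inE.
  apply/imsetP=> -[e']; rewrite inE => /eqP-> [ji _].
  by rewrite ji eqxx in nji.
(* All edges of [out o] share one slot, whose weight bounds their number. *)
have out_le o : #|out o| <= capacity o.
  apply: leq_trans (xrank (out o)) _; rewrite /slot_rank.
  rewrite [X in X + _]big1 => [|j _]; last first.
    rewrite (_ : tree_part _ _ = set0) ?ncomp0 ?subnn //; apply/setP=> e; rewrite !inE.
    by apply/imsetP=> -[e']; rewrite inE => /eqP->.
  have <- : \sum_(o' | o' == o) capacity o' = capacity o by rewrite big_pred1_eq.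
  rewrite add0n big_mkcond [X in _ <= X]big_mkcond.
  apply: leq_sum => o' _; case: ifP => // /imsetP[e]; rewrite inE => /eqP-> [->].
  by rewrite eqxx.
have total : \sum_i #|tree i| + \sum_o #|out o| = #|edge G|.
  pose cls e : 'I_m + option (vertex G) :=
    match x e with inl ie => inl ie.1 | inr o => inr o end.
  rewrite -sum1_card (partition_big cls xpredT) //= big_sumType /=.
  congr addn; apply: eq_bigr => k _; rewrite -sum1_card; apply: eq_bigl => e;
    rewrite inE /cls; move: (xslot e); rewrite inE; case: (x e) => [[i e']|o] //=.
  by case/andP=> /eqP-> _; apply/eqP/eqP => [[->]|[->]].
have tree_le1 i : #|tree i| <= N - 1.
  by apply: leq_trans (tree_le i) (leq_sub2l _ (ncomp_gt0 _ z)).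
have sum_tree : \sum_i #|tree i| <= m * (N - 1).
  by rewrite -[m in m * _]card_ord -sum_nat_const; apply: leq_sum.
have sum_out : \sum_o #|out o| <= \sum_o capacity o by apply: leq_sum.
(* The upper bounds add up to the number of edges, so each of them is attained. *)
have tree_eq i : #|tree i| = N - 1.
  apply/eqP; have := leqif_sum (fun i (_ : true) => leqif_eq (tree_le1 i)).
  case=> _; rewrite sum_nat_const card_ord => E; move: (esym E).
  have -> : \sum_i #|tree i| == m * (N - 1).
    by move: total capacity_total sum_tree sum_out; lia.
  by move/forallP/(_ i).
have out_eq o : #|out o| = capacity o.
  apply/eqP; have := leqif_sum (fun o (_ : true) => leqif_eq (out_le o)).
  case=> _ E; move: (esym E).
  have -> : \sum_o #|out o| == \sum_o capacity o.
    by move: total capacity_total sum_tree sum_out; lia.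
  by move/forallP/(_ o).
(* Having [N - 1] edges under the bound [N - ncomp (tree i)] leaves a single component. *)
have tree_conn i : connected (tree i).
  apply: ncomp1_connected; have := tree_le i; rewrite tree_eq.
  by have := dim_gt0; have := ncomp_le_dim (tree i); lia.
(* Left-over edges outside [M0] also go to [H]; what remains outside [H :|: M0] is exactly the edges
   given to vertices. *)
pose H : factor G := [set e | (e \notin M0) && ~~ [exists v, x e == inr (Some v)]].
have HC e : (e \in ~: (H :|: M0)) = [exists v, x e == inr (Some v)].
  rewrite !inE; case: (boolP (e \in M0)) => eM0; rewrite /= ?orbT ?orbF ?negbK //.
  apply/esym/existsP=> -[v /eqP xe]; have := xslot e.
  by rewrite xe inE eM0.
exists H; split.
- have subT i : exists T : factor G, T \subset tree i /\ spanning_tree T.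
    by have [T sT tT] := spanning_tree_sub (@tree_conn i); exists T.
  have [T hT] := fin_all_exists subT; exists T; split=> [i|i j nij].
    have [sT tT] := hT i; split=> //; apply: subset_trans sT _.
    apply/subsetP=> e; rewrite !inE => /eqP xe; have := xslot e.
    rewrite xe inE => /andP[_ ->] /=.
    by apply/existsP=> -[v].
  apply: disjointWl (hT i).1 _; apply: disjointWr (hT j).1 _.
  rewrite -setI_eq0; apply/eqP/setP=> e; rewrite !inE.
  apply/negP=> /andP[/eqP-> /eqP[ij]].
  by rewrite ij eqxx in nij.
- apply/subsetP=> e eM; rewrite inE (disjointFr hdisj eM) /=.
  apply/existsP=> -[v /eqP xe]; have := xslot e.
  by rewrite xe inE eM andbF.
- by rewrite -setI_eq0; apply/eqP/setP=> e; rewrite !inE; case: (e \in M0); rewrite ?andbF.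
exists set0, (~: (H :|: M0)); split.
- by rewrite set0U.
- by rewrite disjoints_subset sub0set.
- by exists (fun=> set0); split=> -[].
(* Each edge leaves the vertex it was given to; [ends e] is a default value off this factor. *)
pose D e := if x e is inr (Some v) then
    (v, if (ends e).1 == v then (ends e).2 else (ends e).1) else ends e.
exists D; split=> [e|v].
  rewrite HC => /existsP[v /eqP xe]; rewrite /D xe /=.
  have := xslot e; rewrite xe inE => /and3P[_ _]; rewrite /joins.
  case: eqP => [<- _|_ /eqP <-]; first by rewrite -surjective_pairing eqxx.
  by rewrite -surjective_pairing eqxx orbT.
rewrite /out_degree -[demand m z v]/(capacity (Some v)) -out_eq.
rewrite (_ : [set e in _ | _] = out (Some v)) //.
apply/setP=> e; rewrite inE HC !inE /D; apply/andP/eqP => [[/existsP[u /eqP->]]|->].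
  by move=> /eqP /= ->.
by split; [apply/existsP; exists v | ].
Qed.
End Decomposition.

(** * From natural-number demands to the integer bounds of the theorem *)

Lemma partition_connectedW (G : mgraph) m (l l' : vertex G -> int) (F : factor G) :
  (forall v, (l' v <= l v)%R) -> partition_connected m l F -> partition_connected m l' F.
Proof.
move=> le [A [B [AB dis tc [D [oD dD]]]]]; exists A, B; split=> //; exists D; split=> // v.
exact: Order.POrderTheory.le_trans (le v) (dD v).
Qed.

Theorem theorem2p4 (m : nat) (G : mgraph) (M M0 : factor G)
    (hM : loopless M) (hM0 : loopless M0) (hdisj : [disjoint M & M0])
    (hdeg : max_degree M <= m) (hcard : #|M0| <= m)
    (hconn : edge_connected G (2 * m)) :
  (exists H : factor G,
    [/\ tree_connected m H, M \subset H, [disjoint H & M0] &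
        partition_connected 0
          (fun v => ((degree [set: edge G] v)./2%:Z - m%:Z)%R)
          (~: (H :|: M0))]) /\
  (forall z : vertex G, exists H : factor G,
    [/\ tree_connected m H, M \subset H, [disjoint H & M0] &
        partition_connected 0
          (fun v => ((if v == z then uphalf (degree [set: edge G] v)
                      else (degree [set: edge G] v)./2)%:Z - m%:Z)%R)
          (~: (H :|: M0))]).
Proof.
have main z := tree_orientation_decomposition z hM hM0 hdisj hdeg hcard hconn.
split=> [|z]; last first.
  have [H [tH MH HM0 pH]] := main z; exists H; split=> //.
  by apply: partition_connectedW pH => v; rewrite /demand; lia.
(* Any vertex can serve as [z], as rounding up only strengthens the bound; the graph without
   vertices is treated apart. *)
case: (pickP (@predT (vertex G))) => [z _|noV].
  have [H [tH MH HM0 pH]] := main z; exists H; split=> //.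
  by apply: partition_connectedW pH => v; rewrite /demand; case: eqP; lia.
have noE (F : factor G) : F = set0.
  by apply/setP=> e; have := noV (ends e).1.
exists set0; split.
- exists (fun=> set0); split=> [i|i j _]; last by rewrite disjoints_subset sub0set.
  by split; [exact: sub0set | split=> u; have := noV u].
- by rewrite (noE M).
- by rewrite disjoints_subset sub0set.
exists set0, set0; split.
- by rewrite set0U (noE (~: _)).
- by rewrite disjoints_subset sub0set.
- by exists (fun=> set0); split=> -[].
by exists (@ends G); split=> [e|v]; [rewrite inE | have := noV v].
Qed.
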